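(* Let $(W,S)$ be a chordal Coxeter system of finite rank, and let $S'$ be another set of Coxeter generators for $W$. Then $(W,S')$ is chordal.
   Context: A Coxeter system $(W,S)$: $W=\langle S\mid (st)^{m(s,t)}\ (m(s,t)<\infty)\rangle$ with $m(s,s)=1$, $m(s,t)=m(t,s)\in\{2,3,\dots,\infty\}$ for $s\ne t$; $S$ is a set of Coxeter generators. The P-diagram $\Gamma(W,S)$ is the labeled graph with vertex set $S$ and an edge $\{s,t\}$ labeled $m(s,t)$ whenever $s\neq t$ and $m(s,t)<\infty$. $(W,S)$ is chordal if every cycle of length at least four in the underlying graph of $\Gamma(W,S)$ has a chord. *)

(* Defs.v *)
From Stdlib Require Import Arith List.

Record group := Group {
  carrier :> Type;
  gmul : carrier -> carrier -> carrier;
  gone : carrier;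
  ginv : carrier -> carrier;
  gmulA : forall x y z, gmul x (gmul y z) = gmul (gmul x y) z;
  gmul1 : forall x, gmul gone x = x;
  gmulV : forall x, gmul (ginv x) x = gone
}.

Arguments gmul {g} _ _.
Arguments gone {g}.
Arguments ginv {g} _.

Fixpoint gpow {G : group} (x : G) (n : nat) : G :=
  match n with O => gone | S k => gmul x (gpow x k) end.

Definition is_hom {G H : group} (phi : G -> H) : Prop :=
  forall x y, phi (gmul x y) = gmul (phi x) (phi y).

(** A Coxeter matrix on an index set [I]: [m i j = None] means m(i,j) = infinity. *)
Definition coxeter_matrix {I : Type} (m : I -> I -> option nat) : Prop :=
  (forall i, m i i = Some 1) /\
  (forall i j, m i j = m j i) /\
  (forall i j k, i <> j -> m i j = Some k -> 2 <= k).

(** [(W,S)] is a Coxeter system with Coxeter matrix [m]: the set of generators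
    [S] is the (injective) image of [s : I -> W], and
    W = < S | (s t)^{m(s,t)}, m(s,t) < infinity >, expressed by the universal
    property of the presentation: every assignment of the generators into a
    group satisfying the relations extends uniquely to a homomorphism. *)
Definition coxeter_presentation (W : group) (I : Type) (s : I -> W)
    (m : I -> I -> option nat) : Prop :=
  (forall i j, s i = s j -> i = j) /\
  coxeter_matrix m /\
  (forall i j k, m i j = Some k -> gpow (gmul (s i) (s j)) k = gone) /\
  (forall (G : group) (f : I -> G),
     (forall i j k, m i j = Some k -> gpow (gmul (f i) (f j)) k = gone) ->
     exists phi : W -> G, is_hom phi /\ (forall i, phi (s i) = f i)) /\
  (forall (G : group) (phi psi : W -> G), is_hom phi -> is_hom psi ->
     (forall i, phi (s i) = psi (s i)) -> forall w, phi w = psi w).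

Definition finite_type (I : Type) : Prop := exists l : list I, forall i, In i l.

Definition pdiag_adj {I : Type} (m : I -> I -> option nat) (i j : I) : Prop :=
  i <> j /\ m i j <> None.

Definition is_cycle {I : Type} (adj : I -> I -> Prop) (c : nat -> I) (n : nat) : Prop :=
  (forall a b, a < n -> b < n -> c a = c b -> a = b) /\
  (forall k, k < n -> adj (c k) (c ((k + 1) mod n))).

Definition has_chord {I : Type} (adj : I -> I -> Prop) (c : nat -> I) (n : nat) : Prop :=
  exists a b, a < n /\ b < n /\ a <> b /\
    b <> (a + 1) mod n /\ a <> (b + 1) mod n /\ adj (c a) (c b).

Definition chordal_graph {I : Type} (adj : I -> I -> Prop) : Prop :=
  forall (c : nat -> I) (n : nat), 4 <= n -> is_cycle adj c n -> has_chord adj c n.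

Definition chordal {I : Type} (m : I -> I -> option nat) : Prop :=
  chordal_graph (pdiag_adj m).

(* Main.v *)
(* If W splits as <A1> *_<C> <A2> along a separating set C of the P-diagram, it acts on the
   Bass-Serre tree T, and an involution which has a fixed point either fixes a given edge or has
   its fixed subtree strictly on one side of it.  Two involutions whose product has finite order
   never have their subtrees on opposite sides of an edge.

   Let x_0, ..., x_(n-1) be the generators in S' along a chordless cycle of length n >= 4.
   Conjugate the family so that the total S-length is minimal and let A be a subset of S with all
   x_k in <A>.  If A is not complete, chordality of S gives a clique C separating A.  When some edge
   of the tree of <A> = <A1> *_<C> <A2> separates the subtrees of two of the x_k, both arcs of the
   cycle between them contain an element fixing this edge; so two non-consecutive x_a, x_b lie
   in one conjugate of <C>.  Otherwise minimality of the length puts the whole family into <A1> or <A2>,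
   and A can be reduced.  Thus in all cases two non-consecutive x_a, x_b lie in g<V>g^-1 for some
   clique V of S.

   This is impossible: x_a and x_b have infinite m', so W also splits over
   <S' - {x_a, x_b}>, and x_a, x_b lie on opposite sides of the base edge of the corresponding
   tree, while the generators of g<V>g^-1, whose pairwise products have finite order, cannot
   be separated, so <V> has a fixed point (Serre's argument).

   The trees are never constructed: their edges are cosets of <C>, the two sides of the base
   edge are read off the left descents of minimal coset representatives, and all the
   geometry reduces to ping-pong between the two sides. *)

Require Import Defs.
From Stdlib Require Import Arith List Lia Bool Reals Lra.
From Stdlib Require Import Classical ClassicalEpsilon FunctionalExtensionality ProofIrrelevance.

Declare Scope grp_scope.
Delimit Scope grp_scope with grp.
Local Open Scope grp_scope.
Local Arguments xorb : simpl never.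
Local Notation "x * y" := (gmul x y) : grp_scope.
Local Notation "1" := gone : grp_scope.
Local Notation "x ^-1" := (ginv x) (at level 3, format "x ^-1") : grp_scope.

(** * Groups *)

Section GroupTheory.
Context {G : group}.
Implicit Types x y z : G.

Lemma gcancel_l x y z : x * y = x * z -> y = z.
Proof.
  intro E. rewrite <- (gmul1 _ y), <- (gmul1 _ z), <- (gmulV _ x), <- !gmulA. now rewrite E.
Qed.

Lemma gmulVr x : x * x^-1 = 1.
Proof. apply (gcancel_l x^-1). rewrite gmulA, gmulV, gmul1.
  apply (gcancel_l (x^-1)^-1). now rewrite gmulA, gmulV, gmul1.
Qed.

Lemma gmul1r x : x * 1 = x.
Proof. rewrite <- (gmulV _ x), gmulA, gmulVr. apply gmul1. Qed.

Lemma gmulKV x y : x * (x^-1 * y) = y.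
Proof. now rewrite gmulA, gmulVr, gmul1. Qed.

Lemma gmulK x y : x^-1 * (x * y) = y.
Proof. now rewrite gmulA, gmulV, gmul1. Qed.

Lemma ginv_unique x y : x * y = 1 -> y = x^-1.
Proof. intro E. apply (gcancel_l x). now rewrite gmulVr. Qed.

Lemma ginvK x : (x^-1)^-1 = x.
Proof. symmetry. apply ginv_unique, gmulV. Qed.

Lemma gassoc x y z : x * y * z = x * (y * z).
Proof. symmetry. apply gmulA. Qed.

Lemma ginvM x y : (x * y)^-1 = y^-1 * x^-1.
Proof. symmetry. apply ginv_unique. now rewrite gassoc, gmulKV, gmulVr. Qed.

Lemma ginv1 : (1 : G)^-1 = 1.
Proof. symmetry. apply ginv_unique. now rewrite gmul1. Qed.

Lemma gcancel_r x y z : y * x = z * x -> y = z.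
Proof.
  intro E. rewrite <- (gmul1r y), <- (gmul1r z), <- (gmulVr x), !gmulA. now rewrite E.
Qed.

Lemma gpow_comm x n : x * gpow x n = gpow x n * x.
Proof.
  induction n as [|n IH]; simpl.
  - now rewrite gmul1, gmul1r.
  - now rewrite IH, gmulA, IH.
Qed.

Lemma gpow_add x n k : gpow x (n + k) = gpow x n * gpow x k.
Proof.
  induction n as [|n IH]; simpl; [now rewrite gmul1 | now rewrite IH, gmulA].
Qed.

Lemma gpow_conj g x n : gpow (g^-1 * (x * g)) n = g^-1 * (gpow x n * g).
Proof.
  induction n as [|n IH]; simpl.
  - now rewrite gmul1, gmulV.
  - now rewrite IH, !gassoc, gmulKV.
Qed.

Lemma ginv_invol x : x * x = 1 -> x^-1 = x.
Proof. intro E. symmetry. now apply ginv_unique. Qed.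

Lemma gmul_invol x y : x * x = 1 -> x * (x * y) = y.
Proof. intro E. now rewrite gmulA, E, gmul1. Qed.

Lemma conj_invol h x : x * x = 1 -> (h^-1 * (x * h)) * (h^-1 * (x * h)) = 1.
Proof. intro E. now rewrite !gassoc, gmulKV, (gmul_invol x h E), gmulV. Qed.
End GroupTheory.

Ltac gsimp := rewrite ?ginvM, ?ginvK, ?ginv1, ?gassoc;
  repeat progress rewrite ?gmulKV, ?gmulK, ?gmulVr, ?gmulV, ?gmul1, ?gmul1r.

Section Homomorphisms.
Context {G H : group} (phi : G -> H) (Hphi : is_hom phi).

Lemma hom1 : phi 1 = 1.
Proof.
  apply (gcancel_l (phi 1)). now rewrite <- Hphi, gmul1, gmul1r.
Qed.

Lemma hom_pow x n : phi (gpow x n) = gpow (phi x) n.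
Proof.
  induction n as [|n IH]; simpl; [apply hom1 | now rewrite Hphi, IH].
Qed.
End Homomorphisms.

Lemma least_nat (P : nat -> Prop) :
  (exists n, P n) -> exists n, P n /\ forall k, P k -> n <= k.
Proof.
  intros [n Hn]. revert Hn. induction n as [n IH] using (well_founded_induction lt_wf).
  intro Hn. destruct (classic (exists k, k < n /\ P k)) as [[k [Hk Pk]]|No].
  - exact (IH k Hk Pk).
  - exists n. split; [assumption|]. intros k Pk.
    destruct (le_lt_dec n k); [assumption|]. exfalso; eauto.
Qed.

(** * Subgroups, a wreath product and groups of bijections *)

Lemma sig_ext {T : Type} {P : T -> Prop} (a b : sig P) : proj1_sig a = proj1_sig b -> a = b.
Proof.
  destruct a as [a Ha], b as [b Hb]; simpl. intros ->. f_equal. apply proof_irrelevance.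
Qed.

Definition sub_group (G : group) (P : G -> Prop) (P1 : P 1)
  (PM : forall x y, P x -> P y -> P (x * y)) (PV : forall x, P x -> P x^-1) : group.
Proof.
  refine (Group (sig P)
    (fun a b => exist P (proj1_sig a * proj1_sig b) (PM _ _ (proj2_sig a) (proj2_sig b)))
    (exist P 1 P1)
    (fun a => exist P (proj1_sig a)^-1 (PV _ (proj2_sig a))) _ _ _);
  intros; apply sig_ext; simpl.
  - apply gmulA.
  - apply gmul1.
  - apply gmulV.
Defined.

(* The semidirect product of [W -> bool] (pointwise [xorb]) and [W] acting by conjugation. *)
Definition wreath (W : group) : group.
Proof.
  refine (Group ((W -> bool) * W)%type
    (fun a b => ((fun x => xorb (fst a x) (fst b ((snd a)^-1 * (x * snd a)))), snd a * snd b))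
    ((fun _ => false), 1)
    (fun a => ((fun x => fst a (snd a * (x * (snd a)^-1))), (snd a)^-1)) _ _ _).
  - intros [N u] [M v] [L w]; simpl. f_equal; [|apply gmulA].
    extensionality x. gsimp. now rewrite xorb_assoc.
  - intros [N u]; simpl. f_equal; [|apply gmul1].
    extensionality x. rewrite xorb_false_l. f_equal. gsimp. reflexivity.
  - intros [N u]; simpl. f_equal; [|apply gmulV].
    extensionality x. gsimp. apply xorb_nilpotent.
Defined.

(** Each bijection carries its inverse, so that inversion in the group is a swap. *)
Definition bij_group (V : Type) : group.
Proof.
  refine (Group {a : (V -> V) * (V -> V) |
      (forall p, fst a (snd a p) = p) /\ (forall p, snd a (fst a p) = p)}
    (fun a b => exist _ (fun p => fst (proj1_sig a) (fst (proj1_sig b) p),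
                         fun p => snd (proj1_sig b) (snd (proj1_sig a) p)) _)
    (exist _ (fun p => p, fun p => p) _)
    (fun a => exist _ (snd (proj1_sig a), fst (proj1_sig a)) _) _ _ _).
  Unshelve.
  4: { destruct a as [[f f'] [H1 H2]], b as [[g g'] [H3 H4]]; simpl in *.
       split; intro p; [rewrite H3 | rewrite H2]; auto. }
  4: { simpl; auto. }
  4: { destruct a as [[f f'] [H1 H2]]; simpl in *; auto. }
  - intros; apply sig_ext; reflexivity.
  - intros [[f f'] [H1 H2]]; apply sig_ext; reflexivity.
  - intros [[f f'] [H1 H2]]; apply sig_ext; simpl in *. f_equal; extensionality p; auto.
Defined.

(** Words without inverses suffice, since the [s i] will be involutions. *)
Definition gen {W : group} {I : Type} (s : I -> W) (J : I -> Prop) (w : W) : Prop :=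
  exists l, Forall J l /\ fold_right (fun i v => s i * v) 1 l = w.

(** * Clique separators of chordal graphs *)

Section CliqueSeparator.
Local Open Scope nat_scope.
Context {I : Type} {adj : I -> I -> Prop} (adj_sym : forall i j, adj i j -> adj j i).

Inductive conn (P : I -> Prop) (x : I) : I -> Prop :=
| conn_refl : P x -> conn P x x
| conn_step y z : conn P x y -> adj y z -> P z -> conn P x z.

Lemma conn_trans P x y z : conn P x y -> conn P y z -> conn P x z.
Proof. intros Hxy Hyz. induction Hyz; eauto using conn_step. Qed.

Lemma conn_mem P x y : conn P x y -> P x /\ P y.
Proof. induction 1; tauto. Qed.

Lemma conn_sym P x y : conn P x y -> conn P y x.
Proof.
  induction 1 as [|y z H IH Hyz Hz]; [now constructor|].
  apply conn_trans with y; [|assumption].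
  apply conn_step with z; auto; [now constructor | now apply (conn_mem P x y)].
Qed.

Lemma conn_component P q x y : conn P q x -> conn P x y -> conn (conn P q) x y.
Proof.
  intros Hq H. induction H as [|y z H IH Hyz Hz]; [now constructor|].
  apply conn_step with y; auto. apply conn_trans with x; [assumption|].
  now apply conn_step with y.
Qed.

Definition walk (P : I -> Prop) (x y : I) (n : nat) (f : nat -> I) : Prop :=
  f 0 = x /\ f n = y /\ (forall k, k < n -> adj (f k) (f (S k))) /\
  (forall k, 0 < k < n -> P (f k)).

Lemma conn_walk P x y z : adj z x -> conn P x y ->
  exists n f, 1 <= n /\ walk P z y n f.
Proof.
  intros Hzx H. induction H as [Hx|y t H (n & f & Hn & H0 & H1 & H2 & H3) Hyt Ht].
  - exists 1, (fun k => match k with 0 => z | _ => x end). split; [lia|].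
    repeat split; auto; intros k Hk; [|lia]. now replace k with 0 by lia.
  - apply conn_mem in H. exists (S n), (fun k => if k <=? n then f k else t). split; [lia|].
    repeat split.
    + now rewrite (proj2 (Nat.leb_le 0 n)) by lia.
    + now rewrite (proj2 (Nat.leb_gt (S n) n)) by lia.
    + intros k Hk. rewrite (proj2 (Nat.leb_le k n)) by lia.
      destruct (Nat.leb_spec (S k) n); [now apply H2|].
      replace k with n by lia. now rewrite H1.
    + intros k Hk. rewrite (proj2 (Nat.leb_le k n)) by lia.
      destruct (Nat.eq_dec k n) as [->|]; [rewrite H1; tauto | apply H3; lia].
Qed.

Lemma walk_shortcut P x y n f a b : walk P x y n f -> a < b <= n -> adj (f a) (f b) ->
  walk P x y (n - (b - a) + 1) (fun k => if k <=? a then f k else f (k + (b - a) - 1)).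
Proof.
  intros (H0 & H1 & H2 & H3) Hab Hadj. repeat split.
  - now rewrite (proj2 (Nat.leb_le 0 a)) by lia.
  - rewrite (proj2 (Nat.leb_gt _ a)) by lia. rewrite <- H1. f_equal. lia.
  - intros k Hk. destruct (Nat.leb_spec k a), (Nat.leb_spec (S k) a); try lia.
    + apply H2. lia.
    + replace k with a by lia. now replace (S a + (b - a) - 1) with b by lia.
    + replace (S k + (b - a) - 1) with (S (k + (b - a) - 1)) by lia. apply H2. lia.
  - intros k Hk. destruct (Nat.leb_spec k a); apply H3; lia.
Qed.

Context (chord : chordal_graph adj).

(* The vertex [p] closes a shortest walk from [x] to [y] to a chordless cycle. *)
Lemma common_neighbours_adjacent (P : I -> Prop) p x y n f : x <> y -> ~ P x -> ~ P y ->
  p <> x -> p <> y -> adj p x -> adj p y -> (forall z, P z -> z <> p /\ ~ adj p z) ->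
  2 <= n -> walk P x y n f -> adj x y.
Proof.
  intros Nxy Px Py Npx Npy Hpx Hpy HP Hn Hf. apply NNPP. intro Nadj.
  destruct (least_nat (fun n => 2 <= n /\ exists f, walk P x y n f)) as
    [n0 [[Hn0 [g Hg]] Hmin]]; [eauto|]. clear n f Hn Hf.
  assert (Hchord : forall a b, a + 2 <= b <= n0 -> ~ adj (g a) (g b)).
  { intros a b Hab Had. destruct (Nat.eq_dec (b - a) n0) as [E|E].
    - apply Nadj. destruct Hg as (H0 & H1 & _).
      replace a with 0 in Had by lia. replace b with n0 in Had by lia. now rewrite H0, H1 in Had.
    - assert (H := walk_shortcut _ _ _ _ _ a b Hg ltac:(lia) Had).
      assert (n0 <= n0 - (b - a) + 1); [apply Hmin; split; [lia|eauto] | lia]. }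
  (* A repetition [g a = g b] would make [g a] adjacent to [g (S b)], a chord; at the last index it
     contradicts [x <> y] or [~ P y]. *)
  assert (Hinj' : forall a b, a < b <= n0 -> g a <> g b).
  { intros a b Hab E. destruct Hg as (H0 & H1 & H2 & H3).
    destruct (Nat.eq_dec b n0) as [->|Hb].
    - rewrite H1 in E. destruct (Nat.eq_dec a 0) as [->|]; [congruence|].
      apply Py. rewrite <- E. apply H3. lia.
    - assert (Had : adj (g a) (g (S b))) by (rewrite E; apply H2; lia).
      revert Had. apply Hchord. lia. }
  assert (Hp : forall a, a <= n0 -> g a <> p).
  { intros a Ha E. destruct Hg as (H0 & H1 & H2 & H3).
    destruct (Nat.eq_dec a 0) as [->|]; [congruence|].
    destruct (Nat.eq_dec a n0) as [->|]; [congruence|].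
    destruct (HP (g a)); [apply H3; lia | contradiction]. }
  assert (Hpa : forall a, 0 < a < n0 -> ~ adj p (g a)).
  { intros a Ha. apply HP, Hg, Ha. }
  (* The walk fills the indices up to [n0] and [p] the index [n0 + 1], giving a cycle of length
     [n0 + 2 >= 4]. *)
  set (c := fun k => if k <=? n0 then g k else p).
  assert (c_le : forall k, k <= n0 -> c k = g k).
  { intros k Hk. unfold c. now rewrite (proj2 (Nat.leb_le _ _)). }
  assert (c_gt : forall k, n0 < k -> c k = p).
  { intros k Hk. unfold c. now rewrite (proj2 (Nat.leb_gt _ _)). }
  destruct (chord c (n0 + 2)) as (a & b & Ha & Hb & Nab & Nb & Na & Had); [lia| |].
  - split.
    + assert (lt : forall a b, a < b < n0 + 2 -> c a <> c b).
      { intros a b Hab. destruct (Nat.leb_spec b n0).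
        - rewrite !c_le by lia. apply Hinj'. lia.
        - rewrite c_le, c_gt by lia. apply Hp. lia. }
      intros a b Ha Hb E. destruct (lt_eq_lt_dec a b) as [[H|H]|H]; [|assumption|]; exfalso.
      * now apply (lt a b).
      * now apply (lt b a).
    + destruct Hg as (H0 & H1 & H2 & H3). intros k Hk.
      destruct (Nat.eq_dec k (n0 + 1)) as [->|].
      * replace (n0 + 1 + 1) with (n0 + 2) by lia. rewrite Nat.Div0.mod_same.
        rewrite c_gt, c_le by lia. now rewrite H0.
      * rewrite Nat.mod_small, c_le by lia. destruct (Nat.eq_dec k n0) as [->|].
        -- rewrite c_gt by lia. rewrite H1. auto.
        -- rewrite c_le by lia. rewrite Nat.add_1_r. apply H2. lia.
  - assert (lt : forall a b, a < b < n0 + 2 -> b <> (a + 1) mod (n0 + 2) ->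
      a <> (b + 1) mod (n0 + 2) -> ~ adj (c a) (c b)).
    { clear - c_le c_gt Hchord Hpa Hg adj_sym. intros a b Hab H1 H2.
      rewrite Nat.mod_small in H1 by lia. rewrite (c_le a) by lia.
      destruct (Nat.eq_dec b (n0 + 1)) as [->|].
      - replace (n0 + 1 + 1) with (n0 + 2) in H2 by lia. rewrite Nat.Div0.mod_same in H2.
        rewrite c_gt by lia. intro H. apply adj_sym in H. revert H. apply Hpa. lia.
      - rewrite c_le by lia. apply Hchord. lia. }
    destruct (lt_eq_lt_dec a b) as [[H|H]|H]; [|contradiction|].
    + exact (lt a b (conj H Hb) Nb Na Had).
    + apply adj_sym in Had. exact (lt b a (conj H Ha) Na Nb Had).
Qed.

(* [D2] is the component of [q] in the complement of the closed neighbourhood of [p], and [C]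
   its boundary; thus every vertex of [C] is adjacent to [p]. *)
Lemma clique_separator (A : I -> Prop) p q : A p -> A q -> p <> q -> ~ adj p q ->
  exists C D1 D2 : I -> Prop,
  (forall i, A i -> C i \/ D1 i \/ D2 i) /\
  (forall i, C i -> A i) /\ (forall i, D1 i -> A i) /\ (forall i, D2 i -> A i) /\
  (forall i j, D1 i -> D2 j -> i <> j /\ ~ adj i j) /\
  (forall i j, C i -> C j -> i <> j -> adj i j) /\
  ~ C p /\ ~ D2 p /\ ~ C q /\ ~ D1 q.
Proof.
  intros Ap Aq Npq Hpq. set (P := fun z => A z /\ z <> p /\ ~ adj p z).
  set (D2 := conn P q).
  set (C := fun z => A z /\ ~ D2 z /\ exists d, D2 d /\ adj z d).
  set (D1 := fun z => A z /\ ~ C z /\ ~ D2 z).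
  assert (D2P : forall z, D2 z -> P z) by (intros z Hz; now apply conn_mem in Hz).
  assert (D2q : D2 q) by (constructor; unfold P; auto).
  assert (Cp : forall z, C z -> z <> p /\ adj p z).
  { intros z (Az & Nz & d & Hd & Hzd). assert (z <> p).
    { intros ->. now apply D2P in Hd as (_ & _ & H). }
    split; [assumption|]. apply NNPP. intro H1. apply Nz.
    apply conn_step with d; auto. unfold P. auto. }
  exists C, D1, D2. repeat match goal with |- _ /\ _ => split end.
  - intros i Ai. unfold D1. destruct (classic (C i)), (classic (D2 i)); auto.
  - now intros i [Hi _].
  - now intros i [Hi _].
  - intros i Hi. apply (D2P i Hi).
  - intros i j (Ai & Ci & Di) Dj. split; [intros ->; auto|]. intro H. apply Ci.
    repeat split; eauto.
  - intros x y Cx Cy Nxy. destruct (Cp x Cx), (Cp y Cy).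
    destruct Cx as (Ax & Nx & d & Hd & Hxd), Cy as (Ay & Ny & e & He & Hye).
    (* Step from [x] to its neighbour in [D2], cross the connected set [D2], and step out to [y]. *)
    assert (Hf : exists n f, 2 <= n /\ walk D2 x y n f).
    { assert (H4 : conn D2 d e).
      { apply conn_component; [assumption|]. apply conn_trans with q; [now apply conn_sym | assumption]. }
      destruct (conn_walk _ _ _ _ Hxd H4) as (n & f & Hn & H5 & H6 & H7 & H8).
      exists (S n), (fun k => if k <=? n then f k else y). split; [lia|]. repeat split.
      - now rewrite (proj2 (Nat.leb_le 0 n)) by lia.
      - now rewrite (proj2 (Nat.leb_gt (S n) n)) by lia.
      - intros k Hk. rewrite (proj2 (Nat.leb_le k n)) by lia.
        destruct (Nat.leb_spec (S k) n); [now apply H7|].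
        replace k with n by lia. rewrite H6. auto.
      - intros k Hk. rewrite (proj2 (Nat.leb_le k n)) by lia.
        destruct (Nat.eq_dec k n) as [->|]; [now rewrite H6 | apply H8; lia]. }
    destruct Hf as (n & f & Hn & Hf).
    apply (common_neighbours_adjacent D2 p x y n f); auto.
    intros z Hz. now apply D2P in Hz as (_ & H3 & H4).
  - intro H. now apply Cp in H as [H _].
  - intro H. now apply D2P in H as (_ & H & _).
  - now intros (_ & H & _).
  - now intros (_ & _ & H).
Qed.
End CliqueSeparator.

(** * Coxeter systems *)

Section CoxeterSystem.
Context {W : group} {I : Type} {s : I -> W} {m : I -> I -> option nat}.
Context (HW : coxeter_presentation W I s m).
Implicit Types (u v w x y z : W) (J : I -> Prop) (l : list I).

Local Notation ev := (fold_right (fun i v => s i * v) 1).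
Local Notation gen := (gen s).

Lemma sK i : s i * s i = 1.
Proof.
  destruct HW as (_ & (H1 & _) & H2 & _). generalize (H2 i i _ (H1 i)). simpl. now gsimp.
Qed.

Lemma sV i : (s i)^-1 = s i.
Proof. apply ginv_invol, sK. Qed.

Lemma sKl i w : s i * (s i * w) = w.
Proof. apply gmul_invol, sK. Qed.

Lemma s_inj i j : s i = s j -> i = j.
Proof. apply HW. Qed.

Lemma ev_app l1 l2 : ev (l1 ++ l2) = ev l1 * ev l2.
Proof.
  induction l1 as [|i l IH]; simpl; [now rewrite gmul1 | now rewrite IH, gmulA].
Qed.

Lemma ev_rev l : ev (rev l) = (ev l)^-1.
Proof.
  induction l as [|i l IH]; simpl; [now rewrite ginv1 |].
  rewrite ev_app, IH. simpl. now rewrite ginvM, sV, gmul1r.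
Qed.

Lemma gen_one J : gen J 1.
Proof. exists nil. auto. Qed.

Lemma gen_s J i : J i -> gen J (s i).
Proof. exists (i :: nil). simpl. rewrite gmul1r. auto. Qed.

Lemma gen_mul J u v : gen J u -> gen J v -> gen J (u * v).
Proof.
  intros [a [Ha <-]] [b [Hb <-]]. exists (a ++ b). split; [|apply ev_app].
  now apply Forall_app.
Qed.

Lemma gen_inv J u : gen J u -> gen J u^-1.
Proof.
  intros [a [Ha <-]]. exists (rev a). split; [|apply ev_rev]. now apply Forall_rev.
Qed.

Lemma gen_mono J K u : (forall i, J i -> K i) -> gen J u -> gen K u.
Proof.
  intros HJK [a [Ha E]]. exists a. split; [|assumption]. eapply Forall_impl; eauto.
Qed.

Lemma gen_ind J (P : W -> Prop) :
  P 1 -> (forall i w, J i -> P w -> P (s i * w)) -> forall w, gen J w -> P w.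
Proof.
  intros P1 PS w [l [Hl <-]]. induction Hl; simpl; auto.
Qed.

(* The universal property gives a map to the subgroup generated by [s]; composed with the
   inclusion it must be the identity. *)
Lemma gen_all w : gen (fun _ => True) w.
Proof.
  pose (K := sub_group W (gen (fun _ => True)) (gen_one _) (gen_mul _) (gen_inv _)).
  destruct HW as (_ & _ & H2 & H3 & H4).
  assert (inc : is_hom (fun a : K => proj1_sig a)) by (intros a b; reflexivity).
  pose (f := fun i => exist (gen (fun _ => True)) (s i) (gen_s _ i Logic.I) : K).
  destruct (H3 K f) as [phi [Hphi Es]].
  - intros i j k E. apply sig_ext. rewrite (hom_pow _ inc), inc. simpl. eauto.
  - assert (E : proj1_sig (phi w) = w).
    { apply (H4 W (fun w => proj1_sig (phi w)) (fun w => w)).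
      - intros a b. now rewrite Hphi, inc.
      - intros a b. reflexivity.
      - intro i. now rewrite Es. }
    rewrite <- E. apply proj2_sig.
Qed.

(** * Dihedral reflections and the inversion cocycle *)

Local Definition delta (y x : W) : bool := if excluded_middle_informative (x = y) then true else false.

Lemma delta_true y x : delta y x = true <-> x = y.
Proof. unfold delta. destruct (excluded_middle_informative (x = y)); intuition congruence. Qed.

Lemma delta_ext y x y' x' : (x = y <-> x' = y') -> delta y x = delta y' x'.
Proof.
  unfold delta.
  destruct (excluded_middle_informative (x = y)), (excluded_middle_informative (x' = y'));
  tauto.
Qed.

(** The parity of the number of [k < n] with [gpow r k * y = x]. For [r = s i * s j] and [y = s i]
    these are the reflections in the walls crossed successively by an alternating word. *)
Local Fixpoint dsum (y r : W) (n : nat) (x : W) : bool :=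
  match n with O => false | S n => xorb (dsum y r n x) (delta (gpow r n * y) x) end.

(** For [k = n] the two halves cancel, which yields the Coxeter relations in [wreath W]. *)
Lemma dsum_add y r n k x : gpow r n = 1 -> dsum y r (n + k) x = xorb (dsum y r n x) (dsum y r k x).
Proof.
  intro E. induction k as [|k IH]; simpl.
  - now rewrite Nat.add_0_r, xorb_false_r.
  - rewrite Nat.add_succ_r. simpl. now rewrite IH, gpow_add, E, gmul1, xorb_assoc.
Qed.

Lemma gpow_dihedral i j n :
  s i * (gpow (s j * s i) n * (s j * s i)) = gpow (s i * s j) (S n) * s i.
Proof.
  induction n as [|n IH]; simpl in *.
  - now gsimp.
  - rewrite !gassoc in *. now rewrite IH.
Qed.

(** Conjugation by [s i] carries the reflections of the word starting with [s j] to those of the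
    word starting with [s i], apart from the first one. *)
Lemma dsum_front i j n x :
  dsum (s i) (s i * s j) (S n) x =
  xorb (delta (s i) x) (dsum (s j) (s j * s i) n (s i * (x * s i))).
Proof.
  induction n as [|n IH].
  - simpl. now rewrite gmul1, xorb_false_r, xorb_false_l.
  - change (dsum (s i) (s i * s j) (S (S n)) x) with
      (xorb (dsum (s i) (s i * s j) (S n) x) (delta (gpow (s i * s j) (S n) * s i) x)).
    rewrite IH. simpl dsum at 2. rewrite xorb_assoc. do 2 f_equal.
    apply delta_ext. rewrite <- gpow_dihedral. split; intro E.
    + rewrite E. rewrite ?gassoc, sK, sKl. now gsimp.
    + apply (gcancel_l (s i)), (gcancel_r (s i)). rewrite ?gassoc in *. now rewrite E, sKl, sK, gmul1r.
Qed.

Local Fixpoint alt (i j : I) (n : nat) : W :=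
  match n with O => 1 | S n => s i * alt j i n end.

Local Definition refl_lift (i : I) : wreath W := (delta (s i), s i).

Local Fixpoint altF (i j : I) (n : nat) : wreath W :=
  match n with O => 1 | S n => refl_lift i * altF j i n end.

Lemma altF_spec n : forall i j, altF i j n = (dsum (s i) (s i * s j) n, alt i j n).
Proof.
  induction n as [|n IH]; intros i j; [reflexivity|].
  change (altF i j (S n)) with (refl_lift i * altF j i n). rewrite IH.
  simpl gmul. simpl alt. f_equal. extensionality x. rewrite dsum_front. now rewrite sV.
Qed.

Lemma altF_pow i j n : gpow (refl_lift i * refl_lift j) n = altF i j (n + n).
Proof.
  induction n as [|n IH]; [reflexivity|].
  rewrite Nat.add_succ_r.
  change (gpow (refl_lift i * refl_lift j) (S n)) with
    (refl_lift i * refl_lift j * gpow (refl_lift i * refl_lift j) n). now rewrite IH, gassoc.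
Qed.

Lemma alt_pow i j n : alt i j (n + n) = gpow (s i * s j) n.
Proof.
  induction n as [|n IH]; [reflexivity|].
  rewrite Nat.add_succ_r. simpl. now rewrite IH, gassoc.
Qed.

(* [N w] is the characteristic function of the set of reflections whose wall separates
   [1] from [w]. *)
Lemma inversion_cocycle : exists N : W -> W -> bool,
  (forall u v x, N (u * v) x = xorb (N u x) (N v (u^-1 * (x * u)))) /\
  (forall i x, N (s i) x = true <-> x = s i).
Proof.
  destruct HW as (_ & _ & H2 & H3 & H4).
  destruct (H3 (wreath W) refl_lift) as [phi [Hphi Es]].
  - intros i j k E. rewrite altF_pow, altF_spec.
    assert (E1 := H2 i j k E). simpl. f_equal; [|now rewrite alt_pow].
    extensionality x. rewrite dsum_add by assumption. apply xorb_nilpotent.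
  - assert (E : forall w, snd (phi w) = w).
    { apply (H4 W (fun w => snd (phi w)) (fun w => w)).
      - intros a b. now rewrite Hphi.
      - intros a b. reflexivity.
      - intro i. now rewrite Es. }
    exists (fun w => fst (phi w)). split.
    + intros u v x. rewrite Hphi. simpl. now rewrite E.
    + intros i x. rewrite Es. apply delta_true.
Qed.

(** * Infinite order of products, by the geometric representation *)

Section GeometricRepresentation.
Local Open Scope R_scope.

(** The matrix of the Tits bilinear form. *)
Let B (i j : I) : R := match m i j with Some k => - cos (PI / INR k) | None => -1 end.

Lemma B_diag i : B i i = 1.
Proof.
  unfold B. destruct HW as (_ & (H & _) & _). rewrite H. simpl INR.
  replace (PI / 1) with PI by field. rewrite cos_PI. ring.
Qed.

Lemma B_sym i j : B i j = B j i.
Proof. unfold B. destruct HW as (_ & (_ & H & _) & _). now rewrite H. Qed.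

(* The contragredient of the geometric representation: [p u] is the value of a linear form at
   the simple root of [u].  In this form no finiteness of [I] is needed. *)
Let act (i : I) (p : I -> R) : I -> R := fun h => p h - 2 * B i h * p i.

Lemma act_invol i p : act i (act i p) = p.
Proof. extensionality u. unfold act. rewrite B_diag. ring. Qed.

Let geo (i : I) : bij_group (I -> R) :=
  exist _ (act i, act i) (conj (act_invol i) (act_invol i)).

Let app (a : bij_group (I -> R)) := fst (proj1_sig a).

Lemma bij_ext (a b : bij_group (I -> R)) : (forall p, app a p = app b p) -> a = b.
Proof.
  intro H. apply sig_ext. destruct a as [[f f'] [H1 H2]], b as [[g g'] [H3 H4]].
  unfold app in H. simpl in *. f_equal; extensionality p; [apply H|].
  rewrite <- (H4 (f' p)), <- H, H1. reflexivity.
Qed.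

Lemma app_pow_S i j n p :
  app (gpow (geo i * geo j)%grp (S n)) p = act i (act j (app (gpow (geo i * geo j)%grp n) p)).
Proof. reflexivity. Qed.

(** Induction step for powers of a rotation: [a], [b] are cosine and sine of [t], and [C], [S] those
    of [2nt]. The factor [2 * (b * b)] avoids division. *)
Lemma rotation_step (a b C S : R) : b * b = 1 - a * a ->
  forall x y al be : R,
  al * (2 * (b * b)) = y * (a - (C * a - S * b)) + x * (1 - C) ->
  be * (2 * (b * b)) = y * (1 - C) + x * (a - (C * a + S * b)) ->
  let C' := C * (a * a - b * b) - S * (2 * b * a) in
  let S' := S * (a * a - b * b) + C * (2 * b * a) in
  let yn := y + 2 * a * al - 2 * be in
  (al + (x - 2 * al + 2 * a * be + 2 * a * yn)) * (2 * (b * b)) =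
    y * (a - (C' * a - S' * b)) + x * (1 - C') /\
  (be + yn) * (2 * (b * b)) = y * (1 - C') + x * (a - (C' * a + S' * b)).
Proof.
  intros E x y al be Ea Eb. cbv zeta. split.
  - transitivity ((4 * a * a - 1) * (al * (2 * (b * b))) - 2 * a * (be * (2 * (b * b))) +
      (x + 2 * a * y) * (2 * (b * b))); [ring|]. rewrite Ea, Eb. ring [E].
  - transitivity (2 * a * (al * (2 * (b * b))) - be * (2 * (b * b)) + y * (2 * (b * b)));
      [ring|]. rewrite Ea, Eb. ring [E].
Qed.

(** The two reflections generate a rotation by [2t], so the coefficients [al], [be] of its powers
    are trigonometric; at [n = k] the angle is a full turn and both vanish. *)
Lemma geo_pow_finite i j k n : i <> j -> m i j = Some k ->
  let t := PI / INR k in let c := cos (2 * INR n * t) in let sn := sin (2 * INR n * t) in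
  forall p, exists al be,
  al * (2 * (sin t * sin t)) = p j * (cos t - (c * cos t - sn * sin t)) + p i * (1 - c) /\
  be * (2 * (sin t * sin t)) = p j * (1 - c) + p i * (cos t - (c * cos t + sn * sin t)) /\
  forall h, app (gpow (geo i * geo j)%grp n) p h = p h - 2 * B i h * al - 2 * B j h * be.
Proof.
  intros Nij E t. cbv zeta. intro p. induction n as [|n (al & be & Ea & Eb & IH)].
  - exists 0, 0. replace (2 * INR 0 * t) with 0 by (simpl; ring). rewrite cos_0, sin_0.
    split; [ring|split; [ring|]]. intro u. cbn. ring.
  - assert (Et : sin t * sin t = 1 - cos t * cos t).
    { generalize (sin2_cos2 t). unfold Rsqr. lra. }
    assert (Bij : 2 * B i j = - (2 * cos t)) by (unfold B; rewrite E; fold t; ring).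
    destruct (rotation_step _ _ _ _ Et _ _ _ _ Ea Eb) as [Ea' Eb'].
    set (yn := p j + 2 * cos t * al - 2 * be) in *.
    exists (al + (p i - 2 * al + 2 * cos t * be + 2 * cos t * yn)), (be + yn).
    replace (2 * INR (S n) * t) with (2 * INR n * t + 2 * t) by (rewrite S_INR; ring).
    rewrite cos_plus, sin_plus, cos_2a, sin_2a.
    split; [exact Ea'|]. split; [exact Eb'|].
    intro u. rewrite app_pow_S. unfold act. rewrite !IH, !B_diag, (B_sym j i).
    assert (Bij' : B i j = - cos t) by lra. rewrite Bij'. unfold yn. ring.
Qed.

Lemma geo_relation i j k : m i j = Some k -> gpow (geo i * geo j)%grp k = gone.
Proof.
  intro E. apply bij_ext. intro p. extensionality u.
  destruct (classic (i = j)) as [<-|Nij].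
  - destruct HW as (_ & (H & _) & _). rewrite H in E. injection E as <-.
    rewrite app_pow_S. cbn. now rewrite act_invol.
  - destruct (geo_pow_finite i j k k Nij E p) as (al & be & Ea & Eb & ->).
    assert (Hk : (2 <= k)%nat) by (destruct HW as (_ & (_ & _ & H) & _); eauto).
    assert (Hk' : 2 <= INR k) by (apply (le_INR 2); assumption).
    replace (2 * INR k * (PI / INR k)) with (2 * PI) in Ea, Eb by (field; lra).
    rewrite cos_2PI, sin_2PI in Ea, Eb.
    assert (Hs : 0 < sin (PI / INR k)).
    { assert (HP := PI_RGT_0). apply sin_gt_0.
      - apply Rdiv_lt_0_compat; lra.
      - apply (Rmult_lt_reg_r (INR k)); [lra|]. unfold Rdiv.
        rewrite Rmult_assoc, Rinv_l; nra. }
    assert (Hs2 : 2 * (sin (PI / INR k) * sin (PI / INR k)) <> 0) by nra.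
    assert (al = 0) as ->.
    { apply (Rmult_eq_reg_r (2 * (sin (PI / INR k) * sin (PI / INR k)))); [|assumption]. lra. }
    assert (be = 0) as ->.
    { apply (Rmult_eq_reg_r (2 * (sin (PI / INR k) * sin (PI / INR k)))); [|assumption]. lra. }
    cbn. ring.
Qed.

(** The linear growth of these values shows that no positive power is trivial. *)
Lemma geo_pow_infinite i j n : m i j = None ->
  app (gpow (geo i * geo j)%grp n) (fun _ => 1) i = 1 - 4 * INR n /\
  app (gpow (geo i * geo j)%grp n) (fun _ => 1) j = 1 + 4 * INR n.
Proof.
  intro E. induction n as [|n [IHi IHj]].
  - cbn. lra.
  - rewrite !app_pow_S, S_INR. unfold act. rewrite !B_diag, (B_sym j i), IHi, IHj.
    replace (B i j) with (-1) by (unfold B; now rewrite E). lra.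
Qed.

Lemma infinite_order i j n : m i j = None -> gpow (s i * s j)%grp (S n) <> gone.
Proof.
  intros E H. destruct HW as (_ & _ & _ & H3 & _).
  destruct (H3 _ geo geo_relation) as [phi [Hphi Es]].
  assert (E1 : gpow (geo i * geo j)%grp (S n) = gone).
  { assert (Ep : phi (s i * s j)%grp = (geo i * geo j)%grp).
    { etransitivity; [apply Hphi|]. apply f_equal2; apply Es. }
    rewrite <- Ep. etransitivity; [symmetry; apply (hom_pow _ Hphi)|].
    rewrite H. apply (hom1 _ Hphi). }
  destruct (geo_pow_infinite i j (S n) E) as [_ E2]. rewrite E1 in E2. cbn in E2.
  assert (0 <= INR n) by apply pos_INR. rewrite ?S_INR in E2. destruct n; simpl in *; lra.
Qed.
End GeometricRepresentation.

(** * Word length and strong exchange *)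

Lemma shortest_word w : exists l, ev l = w /\ forall l', ev l' = w -> length l <= length l'.
Proof.
  destruct (least_nat (fun n => exists l, ev l = w /\ length l = n)) as [n [[l [E L]] Hn]].
  - destruct (gen_all w) as [l [_ E]]. eauto.
  - exists l. split; [assumption|]. intros l' E'. rewrite L. apply Hn. eauto.
Qed.

Definition len (w : W) : nat :=
  length (proj1_sig (constructive_indefinite_description _ (shortest_word w))).

Lemma len_word w : exists l, ev l = w /\ length l = len w.
Proof.
  unfold len. destruct (constructive_indefinite_description _ _) as [l [E Hl]]. eauto.
Qed.

Lemma len_le l w : ev l = w -> len w <= length l.
Proof.
  unfold len. destruct (constructive_indefinite_description _ _) as [l' [E Hl]]. simpl. auto.
Qed.

Lemma len_eq0 w : len w = 0 -> w = 1.
Proof.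
  destruct (len_word w) as [[|i l] [E L]]; simpl in *; [auto | lia].
Qed.

Lemma len1 : len 1 = 0.
Proof. assert (H := len_le nil 1 eq_refl). simpl in H. lia. Qed.

Lemma len_pos w : w <> 1 -> 0 < len w.
Proof. intro H. destruct (len w) eqn:E; [|lia]. now apply len_eq0 in E. Qed.

Lemma len_mul u v : len (u * v) <= len u + len v.
Proof.
  destruct (len_word u) as [a [Ea <-]], (len_word v) as [b [Eb <-]].
  rewrite <- length_app. apply len_le. now rewrite ev_app, Ea, Eb.
Qed.

Lemma len_inv w : len w^-1 = len w.
Proof.
  assert (H : forall v, len v^-1 <= len v).
  { intro v. destruct (len_word v) as [a [Ea <-]]. rewrite <- length_rev. apply len_le.
    now rewrite ev_rev, Ea. }
  apply Nat.le_antisymm; [auto|]. rewrite <- (ginvK w) at 1. auto.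
Qed.

Lemma len_s i w : len (s i * w) <= S (len w).
Proof.
  destruct (len_word w) as [a [Ea <-]]. change (S (length a)) with (length (i :: a)).
  apply len_le. simpl. now rewrite Ea.
Qed.

Definition N : W -> W -> bool :=
  proj1_sig (constructive_indefinite_description _ inversion_cocycle).

Lemma N_mul u v x : N (u * v) x = xorb (N u x) (N v (u^-1 * (x * u))).
Proof. unfold N. destruct (constructive_indefinite_description _ _) as [N' HN]. apply HN. Qed.

Lemma N_s i x : N (s i) x = true <-> x = s i.
Proof. unfold N. destruct (constructive_indefinite_description _ _) as [N' HN]. apply HN. Qed.

Lemma N_one x : N 1 x = false.
Proof.
  assert (E := N_mul 1 1 x). revert E. gsimp. now destruct (N 1 x).
Qed.

Lemma N_sl i w x : N (s i * w) x = xorb (N (s i) x) (N w (s i * (x * s i))).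
Proof. now rewrite N_mul, sV. Qed.

Lemma N_descent i w : N (s i * w) (s i) = negb (N w (s i)).
Proof.
  rewrite N_sl, sK, gmul1r. replace (N (s i) (s i)) with true; [apply xorb_true_l|].
  symmetry. now apply N_s.
Qed.

(** By the cocycle rule, some prefix of the word conjugates [x] to the letter that follows it;
    deleting this letter amounts to multiplying by [x]. *)
Lemma strong_exchange J l x : Forall J l -> N (ev l) x = true ->
  exists l', Forall J l' /\ length l' < length l /\ ev l' = x * ev l.
Proof.
  intro HJ. revert x. induction HJ as [|i l Hi Hl IH]; intros x; simpl.
  - now rewrite N_one.
  - rewrite N_sl. destruct (N (s i) x) eqn:E.
    + intros _. apply N_s in E. exists l. rewrite E, sKl. auto.
    + rewrite xorb_false_l. intro Hx. destruct (IH _ Hx) as [l' [H1 [H2 H3]]].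
      exists (i :: l'). simpl. rewrite H3, !gassoc, sKl. repeat split; auto. lia.
Qed.

Lemma len_N w x : N w x = true -> len (x * w) < len w.
Proof.
  destruct (len_word w) as [a [Ea La]]. intro H. rewrite <- Ea in H.
  apply (strong_exchange (fun _ => True)) in H; [|now apply Forall_forall].
  destruct H as [l [_ [H1 H2]]]. rewrite Ea in H2. apply len_le in H2. lia.
Qed.

(** * Descents and minimal coset representatives *)

Lemma len_descent i w : N w (s i) = true -> len w = S (len (s i * w)).
Proof.
  intro H. apply len_N in H. assert (H1 := len_s i (s i * w)). rewrite sKl in H1. lia.
Qed.

(** If the first letter is no descent of the word, it is one of the tail, and exchange gives a
    shorter word over [J] for the same element. *)
Lemma no_descent_one J u : gen J u -> (forall i, J i -> N u (s i) = false) -> u = 1.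
Proof.
  intros [l [Hl <-]]. induction l as [l IH] using (well_founded_induction
    (well_founded_ltof _ (@length I))). unfold ltof in IH.
  intro H. destruct Hl as [|i l Hi Hl]; [reflexivity|]. simpl in *.
  assert (Hn := H i Hi). rewrite N_descent in Hn. apply negb_false_iff in Hn.
  destruct (strong_exchange _ _ _ Hl Hn) as [l' [H1 [H2 H3]]].
  rewrite <- H3 in H |- *. apply IH; auto.
Qed.

Lemma descent_exists J u : gen J u -> u <> 1 -> exists i, J i /\ N u (s i) = true.
Proof.
  intros Hu Nu. apply NNPP. intro No. apply Nu, (no_descent_one J); [assumption|].
  intros i Hi. destruct (N u (s i)) eqn:E; [|reflexivity]. exfalso; eauto.
Qed.

(* Equivalently, [v] is the shortest element of the coset [<J> v]. *)
Definition jmin J v := forall x, gen J x -> N v x = false.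

Lemma jmin_decomp J w : exists u v, gen J u /\ jmin J v /\ w = u * v.
Proof.
  induction w as [w IH] using (well_founded_induction (well_founded_ltof _ len)).
  destruct (classic (jmin J w)) as [Hw|Hw].
  - exists 1, w. rewrite gmul1. split; [apply gen_one | auto].
  - unfold jmin in Hw. apply not_all_ex_not in Hw. destruct Hw as [x Hx].
    apply imply_to_and in Hx. destruct Hx as [Hx Nx].
    apply not_false_iff_true, len_N in Nx. destruct (IH _ Nx) as [u [v [Hu [Hv E]]]].
    exists (x^-1 * u), v. repeat split; auto.
    + apply gen_mul; [now apply gen_inv | assumption].
    + rewrite gassoc, <- E. now gsimp.
Qed.

Lemma jmin_one J : jmin J 1.
Proof. intros x _. apply N_one. Qed.

(** The cocycle evaluates [v] at a conjugate of [x] inside [<J>], where it vanishes; so descents in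
    [J] see only [u]. *)
Lemma N_jmin J u v x : gen J u -> jmin J v -> gen J x -> N (u * v) x = N u x.
Proof.
  intros Hu Hv Hx. rewrite N_mul, Hv; [apply xorb_false_r|].
  apply gen_mul; [now apply gen_inv|]. now apply gen_mul.
Qed.

Lemma jmin_no_descent J v : (forall i, J i -> N v (s i) = false) -> jmin J v.
Proof.
  intro H. destruct (jmin_decomp J v) as [u [v0 [Hu [Hv ->]]]].
  replace u with (1 : W); [now rewrite gmul1|]. symmetry.
  apply (no_descent_one J); [assumption|]. intros i Hi.
  rewrite <- (N_jmin J u v0); auto using gen_s.
Qed.

Lemma jmin_unique J u v u' v' : gen J u -> gen J u' -> jmin J v -> jmin J v' ->
  u * v = u' * v' -> v = v'.
Proof.
  intros Hu Hu' Hv Hv' E.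
  assert (Ev : v = (u^-1 * u') * v') by (rewrite gassoc, <- E; now gsimp).
  assert (Hg : gen J (u^-1 * u')) by (apply gen_mul; [now apply gen_inv | assumption]).
  replace (u^-1 * u') with (1 : W) in Ev; [now rewrite gmul1 in Ev|]. symmetry.
  apply (no_descent_one J); [assumption|]. intros i Hi.
  rewrite <- (N_jmin J _ v'), <- Ev; auto using gen_s.
Qed.

Lemma jmin_gen J v : gen J v -> jmin J v -> v = 1.
Proof.
  intros Hg Hm. apply (no_descent_one J); [assumption|]. intros i Hi. apply Hm, gen_s, Hi.
Qed.

Lemma len_jmin J u v : gen J u -> jmin J v -> len (u * v) = len u + len v.
Proof.
  intros Hu Hv. induction u as [u IH] using (well_founded_induction (well_founded_ltof _ len)).
  unfold ltof in IH. destruct (classic (u = 1)) as [->|Nu].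
  - now rewrite gmul1, len1.
  - destruct (descent_exists J u Hu Nu) as [i [Hi Ni]].
    assert (L1 := len_descent i u Ni).
    rewrite <- (N_jmin J u v) in Ni; auto using gen_s.
    apply len_descent in Ni. rewrite <- gassoc, (IH (s i * u)) in Ni; [lia|lia|].
    apply gen_mul; auto using gen_s.
Qed.

Lemma gen_s_mem J i : gen J (s i) -> J i.
Proof.
  intro H. destruct (descent_exists J (s i)) as [j [Hj Nj]]; [assumption| |].
  - intro E. assert (T : N (s i) (s i) = true) by now apply N_s.
    rewrite E in T at 1. now rewrite N_one in T.
  - apply N_s, s_inj in Nj. now subst.
Qed.

Lemma gen_alt i j u : gen (fun k => k = i \/ k = j) u ->
  exists n, u = alt i j n \/ u = alt j i n.
Proof.
  revert u. apply gen_ind; [now exists 0; left|].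
  intros k w Hk [n [-> | ->]]; destruct Hk as [-> | ->].
  - destruct n as [|n]; [exists 1%nat; now left|]. exists n. right. simpl. apply sKl.
  - exists (S n). now right.
  - exists (S n). now left.
  - destruct n as [|n]; [exists 1%nat; now right|]. exists n. left. simpl. apply sKl.
Qed.

Lemma N_alt n : forall i j x, N (alt i j n) x = true ->
  exists k, x = gpow (s i * s j) k * s i.
Proof.
  induction n as [|n IH]; intros i j x; simpl; [now rewrite N_one|].
  rewrite N_sl. destruct (N (s i) x) eqn:E.
  - intros _. exists 0. simpl. rewrite gmul1. now apply N_s.
  - rewrite xorb_false_l. intro H. destruct (IH _ _ _ H) as [k Hk].
    exists (S k). rewrite <- gpow_dihedral, (gmulA _ (gpow _ _)), <- Hk, !gassoc, sK, sKl. now gsimp.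
Qed.

(** The dihedral part of [v] is an alternating word, say starting with [s i]. As [s j] is an
    inversion of it, [s j] equals some [gpow (s i * s j) k * s i], a torsion relation. *)
Lemma two_descents_torsion v i j : N v (s i) = true -> N v (s j) = true ->
  exists n, gpow (s i * s j) (S n) = 1.
Proof.
  set (J := fun k => k = i \/ k = j). intros Hi Hj.
  destruct (jmin_decomp J v) as [u [v0 [Hu [Hv ->]]]].
  rewrite (N_jmin J) in Hi, Hj by (auto; apply gen_s; unfold J; auto).
  destruct (gen_alt i j u Hu) as [n [-> | ->]].
  - destruct (N_alt _ _ _ _ Hj) as [k E]. exists k.
    simpl. rewrite gpow_comm, <- gassoc, <- E. apply sK.
  - destruct (N_alt _ _ _ _ Hi) as [k E]. exists k. 
    assert (E1 : gpow (s j * s i) (S k) = 1).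
    { simpl. rewrite gpow_comm, <- gassoc, <- E. apply sK. }
    replace (s i * s j) with ((s i)^-1 * ((s j * s i) * s i)).
    + rewrite gpow_conj, E1. now gsimp.
    + rewrite sV, !gassoc, sK. now gsimp.
Qed.

(** * Splittings along a separating set of generators *)

(** Separation is stated as infinite order, the form which contradicts [two_descents_torsion]. *)
Record splitting (A C D1 D2 : I -> Prop) : Prop := {
  split_cover : forall i, A i -> C i \/ D1 i \/ D2 i;
  split_C : forall i, C i -> A i;
  split_D1 : forall i, D1 i -> A i;
  split_D2 : forall i, D2 i -> A i;
  split_sep : forall i j, D1 i -> D2 j -> i <> j /\ forall n, gpow (s i * s j) (S n) <> 1
}.

Definition join (C D : I -> Prop) (i : I) : Prop := C i \/ D i.

(* In the Bass-Serre tree of [<A> = <C+D1> *_<C> <C+D2>] the edges are the cosets of [<C>],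
   and [side C D1], [side C D2] are the two families of edges into which the base edge
   separates the others. *)
Definition side (C D : I -> Prop) (w : W) : Prop :=
  exists u v i, gen C u /\ jmin C v /\ w = u * v /\ D i /\ N v (s i) = true.

Lemma torsion_swap i j n : gpow (s i * s j) (S n) = 1 -> gpow (s j * s i) (S n) = 1.
Proof.
  intro E. replace (s j * s i) with ((s i)^-1 * ((s i * s j) * s i)).
  - rewrite gpow_conj, E. now gsimp.
  - rewrite sV, !gassoc, sKl. reflexivity.
Qed.

Lemma split_sym A C D1 D2 : splitting A C D1 D2 -> splitting A C D2 D1.
Proof.
  intros [H1 H2 H3 H4 H5]. split; auto.
  - intros i Hi. destruct (H1 i Hi) as [|[|]]; auto.
  - intros i j Hi Hj. destruct (H5 j i Hj Hi) as [N1 N2]. split; [congruence|].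
    intros n E. now apply (N2 n), torsion_swap.
Qed.

Lemma side_jmin C D u v : gen C u -> jmin C v -> side C D (u * v) ->
  exists i, D i /\ N v (s i) = true.
Proof.
  intros Hu Hv (u' & v' & i & Hu' & Hv' & E & Hi & Ni).
  rewrite (jmin_unique C u v u' v') by assumption. eauto.
Qed.

Lemma side_gen C D w : gen C w -> ~ side C D w.
Proof.
  intros Hw Hs. rewrite <- (gmul1r w) in Hs.
  apply side_jmin in Hs; [|assumption|apply jmin_one].
  destruct Hs as [i [_ H]]. now rewrite N_one in H.
Qed.

Lemma side_one C D : ~ side C D 1.
Proof. apply side_gen, gen_one. Qed.

Lemma side_mull C D c w : gen C c -> side C D w -> side C D (c * w).
Proof.
  intros Hc (u & v & i & Hu & Hv & -> & Hi). exists (c * u), v, i.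
  split; [now apply gen_mul|]. now rewrite gassoc.
Qed.

Section Split.
Context {A C D1 D2 : I -> Prop} (HS : splitting A C D1 D2).

Lemma side_disjoint w : side C D1 w -> side C D2 w -> False.
Proof.
  intros (u & v & i & Hu & Hv & -> & Hi & Ni) H2.
  apply side_jmin in H2; [|assumption..]. destruct H2 as [j [Hj Nj]].
  destruct (two_descents_torsion _ _ _ Ni Nj) as [n E].
  now apply (split_sep _ _ _ _ HS i j Hi Hj) in E.
Qed.

Lemma join_jmin v : jmin C v -> (forall i, D1 i -> N v (s i) = false) -> jmin (join C D1) v.
Proof.
  intros HC HD. apply jmin_no_descent. intros i [Hi|Hi]; [apply HC, gen_s, Hi | auto].
Qed.

Lemma jmin_join v : jmin (join C D1) v -> jmin C v.
Proof. intros H x Hx. apply H. revert Hx. apply gen_mono. now left. Qed.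

Lemma jmin_join_side v : jmin (join C D1) v -> ~ side C D1 v.
Proof.
  intros Hv Hs. rewrite <- (gmul1 _ v) in Hs.
  apply side_jmin in Hs; [|apply gen_one|now apply jmin_join].
  destruct Hs as [i [Hi Ni]]. rewrite Hv in Ni; [discriminate|]. apply gen_s. now right.
Qed.

Lemma join_A w : gen (join C D1) w -> gen A w.
Proof. apply gen_mono. intros i [Hi|Hi]; [eapply split_C | eapply split_D1]; eauto. Qed.

Lemma C_join w : gen C w -> gen (join C D1) w.
Proof. apply gen_mono. now left. Qed.

Lemma not_side w : ~ side C D1 w -> exists u v, gen C u /\ jmin (join C D1) v /\ w = u * v.
Proof.
  intro H. destruct (jmin_decomp C w) as (u & v & Hu & Hv & ->). exists u, v.
  repeat split; auto. apply join_jmin; [assumption|]. intros i Hi.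
  destruct (N v (s i)) eqn:E; [|reflexivity]. exfalso. apply H. exists u, v, i. auto.
Qed.

(** A minimal representative other than 1 has a descent in [A], which cannot lie in [C]. *)
Lemma side_cases w : gen A w -> gen C w \/ side C D1 w \/ side C D2 w.
Proof.
  intro Hw. destruct (jmin_decomp C w) as (u & v & Hu & Hv & ->).
  assert (Hv' : gen A v).
  { rewrite <- (gmulK u v). apply gen_mul; [|assumption]. apply gen_inv.
    revert Hu. apply gen_mono. apply HS. }
  destruct (classic (v = 1)) as [->|Nv].
  - left. now rewrite gmul1r.
  - right. destruct (descent_exists A v Hv' Nv) as [i [Hi Ni]].
    destruct (split_cover _ _ _ _ HS i Hi) as [H|[H|H]].
    + rewrite Hv in Ni; [discriminate|]. now apply gen_s.
    + left. exists u, v, i. auto.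
    + right. exists u, v, i. auto.
Qed.

(** Write [w = u * v] with [v] minimal for [<C+D1>]. The minimal representative [b] of [a * u]
    modulo [<C>] is nontrivial, its descents lie in [D1], and they survive multiplication by [v]. *)
Lemma ping a w : gen (join C D1) a -> ~ gen C a -> ~ side C D1 w -> side C D1 (a * w).
Proof.
  intros Ha NCa Hw. destruct (not_side w Hw) as (u & v & Hu & Hv & ->).
  destruct (jmin_decomp C (a * u)) as (c & b & Hc & Hb & E).
  assert (Hb' : gen (join C D1) b).
  { rewrite <- (gmulK c b), <- E. repeat apply gen_mul; auto using gen_inv, C_join. }
  assert (Nb : b <> 1).
  { intros ->. apply NCa. replace a with (a * u * u^-1) by now gsimp.
    rewrite E. repeat apply gen_mul; auto using gen_inv, gen_one. }
  destruct (descent_exists _ b Hb' Nb) as [i [Hi Ni]].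
  exists c, (b * v), i. rewrite gmulA, E, gassoc. repeat split; auto.
  - intros x Hx. rewrite (N_jmin _ _ _ _ Hb' Hv); auto using C_join.
  - destruct Hi as [Hi|Hi]; [|assumption]. rewrite Hb in Ni; [discriminate|]. now apply gen_s.
  - rewrite (N_jmin _ _ _ _ Hb' Hv); auto using gen_s.
Qed.

Lemma join_side2 a : gen (join C D1) a -> ~ side C D2 a.
Proof.
  intros Ha H. destruct (classic (gen C a)) as [Hc|Hc].
  - now apply side_gen in H.
  - apply (side_disjoint a); [|assumption]. rewrite <- (gmul1r a).
    apply ping; auto using side_one.
Qed.

(** This splits off the first syllable of the normal form in the amalgam. *)
Lemma side_decomp w : gen A w -> side C D1 w ->
  exists a v, gen (join C D1) a /\ ~ gen C a /\ gen A v /\ jmin (join C D1) v /\ w = a * v /\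
    len v < len w /\ (v = 1 \/ side C D2 v).
Proof.
  intros Hw Hs. destruct (jmin_decomp (join C D1) w) as (a & v & Ha & Hv & ->).
  assert (NCa : ~ gen C a).
  { intro Hc. apply side_jmin in Hs; [|assumption|now apply jmin_join].
    destruct Hs as [i [Hi Ni]]. rewrite Hv in Ni; [discriminate|]. apply gen_s. now right. }
  assert (Hv' : gen A v).
  { rewrite <- (gmulK a v). apply gen_mul; [|assumption]. now apply gen_inv, join_A. }
  exists a, v. repeat split; auto.
  - rewrite (len_jmin _ _ _ Ha Hv). enough (0 < len a) by lia. apply len_pos.
    intros ->. apply NCa, gen_one.
  - destruct (side_cases v Hv') as [H|[H|H]]; auto.
    + left. apply (jmin_gen C); auto using jmin_join.
    + now apply jmin_join_side in H.
Qed.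
End Split.

(** * Ping-pong between the two sides *)

Section SplitTypes.
Context {A C D1 D2 : I -> Prop} (HS : splitting A C D1 D2).

(** The first syllable of [g] determines the target side, the last one the alternative; peeling off
    first syllables gives the induction. *)
Lemma side_translate g : gen A g ->
  (side C D1 g -> (forall w, ~ side C D2 w -> side C D1 (g * w)) \/
                  (forall w, ~ side C D1 w -> side C D1 (g * w))) /\
  (side C D2 g -> (forall w, ~ side C D1 w -> side C D2 (g * w)) \/
                  (forall w, ~ side C D2 w -> side C D2 (g * w))).
Proof.
  assert (HS' := split_sym _ _ _ _ HS).
  assert (aux : forall D1 D2 g, splitting A C D1 D2 ->
    (forall v, len v < len g -> gen A v -> side C D2 v ->
       (forall w, ~ side C D1 w -> side C D2 (v * w)) \/
       (forall w, ~ side C D2 w -> side C D2 (v * w))) ->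
    gen A g -> side C D1 g -> (forall w, ~ side C D2 w -> side C D1 (g * w)) \/
                  (forall w, ~ side C D1 w -> side C D1 (g * w))).
  { clear. intros D1 D2 g HS IH Hg Hs.
    destruct (side_decomp HS g Hg Hs) as (a & v & Ha & NCa & Hv & _ & -> & L & [->|Sv]).
    - right. intros w Hw. rewrite gmul1r. now apply ping.
    - destruct (IH v L Hv Sv) as [H|H]; [right|left]; intros w Hw; rewrite gassoc;
      (apply ping; [assumption..|]); intro H1; apply (side_disjoint HS _ H1); auto. }
  induction g as [g IH] using (well_founded_induction (well_founded_ltof _ len)).
  unfold ltof in IH. intro Hg.
  split; apply aux; auto; intros v L Hv Hs; now apply (IH v L Hv).
Qed.

(** The other alternative of [side_translate] would put [y * y = 1] on a side. *)
Lemma involution_side y w : gen A y -> y * y = 1 -> side C D1 y ->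
  ~ side C D1 w -> side C D1 (y * w).
Proof.
  intros Hy E Hs. destruct (proj1 (side_translate y Hy) Hs) as [H|H]; [|now apply H].
  exfalso. apply (side_one C D1). rewrite <- E. apply H. intro H2.
  exact (side_disjoint HS _ Hs H2).
Qed.

(** The cosets [w a <C>] are the edges at the vertex [w<C+D1>], which lies strictly beyond the base
    edge. *)
Lemma side_mulr w a : gen A w -> side C D2 w -> gen (join C D1) a -> side C D2 (w * a).
Proof.
  assert (HS' := split_sym _ _ _ _ HS). intros Hw Hs Ha. revert Hw Hs.
  induction w as [w IH] using (well_founded_induction (well_founded_ltof _ len)).
  unfold ltof in IH. intros Hw Hs.
  destruct (side_decomp HS' w Hw Hs) as (b & v & Hb & NCb & Hv & _ & -> & L & [->|Sv]).
  - rewrite gmul1r. apply ping; auto. now apply (join_side2 HS).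
  - rewrite gassoc. apply ping; auto.
    destruct (side_decomp HS v Hv Sv) as (a' & v' & Ha' & NCa' & Hv' & _ & -> & L' & [->|Sv']).
    + rewrite gmul1r. apply (join_side2 HS). now apply gen_mul.
    + intro H. apply (side_disjoint HS _) in H; [assumption|]. rewrite gassoc.
      apply ping; auto. intro H1. apply (side_disjoint HS _ H1). apply IH; auto. lia.
Qed.

End SplitTypes.

(** The product maps everything off the second side into the first, so its positive powers move 1
    there. *)
Lemma opposite_sides_free A C D1 D2 y z n : splitting A C D1 D2 -> gen A y -> gen A z ->
  y * y = 1 -> z * z = 1 -> side C D1 y -> side C D2 z -> gpow (y * z) (S n) <> 1.
Proof.
  intros HS Hy Hz Ey Ez Sy Sz E. apply (side_one C D1). rewrite <- E. clear E.
  assert (step : forall w, ~ side C D2 w -> side C D1 (y * (z * w))).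
  { intros w Hw. apply (involution_side HS); auto. intro H. apply (side_disjoint HS _ H).
    apply (involution_side (split_sym _ _ _ _ HS)); auto. }
  induction n as [|n IH]; simpl in *; rewrite gassoc; apply step.
  - apply side_one.
  - intro H. exact (side_disjoint HS _ IH H).
Qed.

(** * Splitting at a pair of generators and Serre's fixed point argument *)

Lemma pair_split (k l : I) : k <> l -> (forall n, gpow (s k * s l) (S n) <> 1) ->
  splitting (fun _ => True) (fun i => i <> k /\ i <> l) (fun i => i = k) (fun i => i = l).
Proof.
  intros N Hn. split; auto.
  - intros i _. destruct (classic (i = k)), (classic (i = l)); auto.
  - now intros i j -> ->.
Qed.

Lemma side_s C D i : ~ C i -> D i -> side C D (s i).
Proof.
  intros NC Hi. exists 1, (s i), i. rewrite gmul1. repeat split; auto using gen_one.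
  - apply jmin_no_descent. intros j Hj. destruct (N (s i) (s j)) eqn:E; [|reflexivity].
    apply N_s, s_inj in E. now subst.
  - now apply N_s.
Qed.

Inductive closure (P : W -> Prop) : W -> Prop :=
| closure_one : closure P 1
| closure_mul x w : P x -> closure P w -> closure P (x * w).

Section FixedPoint.
Context (P : W -> Prop) (P_invol : forall x, P x -> x * x = 1)
  (P_torsion : forall x y, P x -> P y -> exists n, gpow (x * y) (S n) = 1).

(* [side C D1 (h^-1 v h)] says that [v] moves the edge [h<C>] of the tree and has its fixed
   points on the first side of it.  If some [v] in [P] does this, no [u] in [P] has its fixed
   points on the other side, so the edge [u h<C>] is moved in the same way. *)
Lemma side_invariant C D1 D2 : splitting (fun _ => True) C D1 D2 ->
  forall w, closure P w -> (exists v, P v /\ side C D1 v) ->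
  exists v, P v /\ side C D1 (w^-1 * (v * w)).
Proof.
  intros HS w Hw H. induction Hw as [|u h Pu Hh IH].
  - destruct H as [v Hv]. exists v. now gsimp.
  - destruct IH as [v [Pv Hv]]. set (y := h^-1 * (u * h)).
    destruct (side_cases HS y (gen_all y)) as [Hy|[Hy|Hy]].
    + exists v. split; [assumption|].
      replace ((u * h)^-1 * (v * (u * h))) with (y^-1 * ((h^-1 * (v * h)) * y))
        by (unfold y; now gsimp).
      apply side_mull; [now apply gen_inv|].
      apply (side_mulr (split_sym _ _ _ _ HS)); auto using gen_all.
      revert Hy. apply gen_mono. now left.
    + exists u. split; [assumption|].
      replace ((u * h)^-1 * (u * (u * h))) with y; [assumption|].
      unfold y. gsimp. reflexivity.
    + exfalso. destruct (P_torsion v u Pv Pu) as [n E].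
      apply (opposite_sides_free _ C D1 D2 (h^-1 * (v * h)) y n HS);
        auto using gen_all; try (apply conj_invol; auto).
      replace (h^-1 * (v * h) * y) with (h^-1 * ((v * u) * h)) by (unfold y; now gsimp).
      rewrite gpow_conj, E. now gsimp.
Qed.

(** Invariance along [s l] gives [v'] in [P] whose conjugate by [s l] is on the side of [k]. Since
    [s l] is on the side of [l], so is [v'], and [v * v'] would have infinite order. *)
Lemma no_moved_edge C (k l : I) : splitting (fun _ => True) C (fun i => i = k) (fun i => i = l) ->
  ~ C k -> ~ C l -> closure P (s l) -> ~ exists v, P v /\ side C (fun i => i = k) v.
Proof.
  intros HS Ck Cl Hl Hv. destruct (side_invariant _ _ _ HS _ Hl Hv) as [v' [Pv' Hv']].
  destruct Hv as [v [Pv Hv]]. rewrite sV in Hv'.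
  assert (Sl : side C (fun i => i = l) (s l)) by now apply side_s.
  assert (HS' := split_sym _ _ _ _ HS).
  assert (H : side C (fun i => i = l) v').
  { replace v' with (s l * ((s l * (v' * s l)) * s l)) by (rewrite !gassoc, sK, sKl; now gsimp).
    apply (involution_side HS'); auto using gen_all, sK.
    intro H1. apply (side_disjoint HS _) in H1; [assumption|].
    apply (involution_side HS); auto using gen_all.
    - rewrite <- (sV l) at 1 3. apply conj_invol. auto.
    - intro H2. exact (side_disjoint HS _ H2 Sl). }
  destruct (P_torsion v v' Pv Pv') as [n E]. revert E.
  apply (opposite_sides_free _ C _ _ v v' n HS); auto using gen_all.
Qed.

(** As no element of [P] lies on a side, all of [P] is in [<C>], which does not contain [s k]. *)
Lemma infinite_pair_not_generated (k l : I) : k <> l -> (forall n, gpow (s k * s l) (S n) <> 1) ->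
  closure P (s k) -> closure P (s l) -> False.
Proof.
  intros Nkl Hn Hk Hl. set (C := fun i => i <> k /\ i <> l).
  assert (HS : splitting (fun _ => True) C (fun i => i = k) (fun i => i = l)) by now apply pair_split.
  assert (Ck : ~ C k) by (unfold C; tauto). assert (Cl : ~ C l) by (unfold C; tauto).
  apply Ck, gen_s_mem.
  enough (H : forall w, closure P w -> gen C w) by auto.
  intros w Hw. induction Hw as [|v w Pv _ IH]; [apply gen_one|]. apply gen_mul; [|assumption].
  destruct (side_cases HS v (gen_all v)) as [H|[H|H]]; [assumption| |]; exfalso.
  - apply (no_moved_edge C k l); eauto.
  - apply (no_moved_edge C l k); eauto using split_sym.
Qed.
End FixedPoint.

(** * Cyclic families of involutions *)

Section CyclicFamily.
Local Open Scope nat_scope.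

Definition nonconsecutive (n a b : nat) : Prop :=
  a < n /\ b < n /\ a <> b /\ b <> (a + 1) mod n /\ a <> (b + 1) mod n.

(** A discrete intermediate value theorem: [P], [Z], [M] stand for plus, zero and minus. *)
Lemma sign_change (P Z M : nat -> Prop) a d :
  (forall k, P k \/ Z k \/ M k) -> (forall k, P k -> M (S k) -> False) ->
  (forall k, P k -> M k -> False) -> P a -> M (a + d) -> exists e, 0 < e < d /\ Z (a + e).
Proof.
  intros Cov PM Dis Ha. induction d as [|d IH]; intro Hd.
  - rewrite Nat.add_0_r in Hd. exfalso. eauto.
  - rewrite Nat.add_succ_r in Hd. destruct (Cov (a + d)) as [H|[H|H]].
    + exfalso. eauto.
    + destruct d as [|d].
      * rewrite Nat.add_0_r in *. exfalso. eauto.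
      * exists (S d). split; [lia | assumption].
    + destruct (IH H) as [e [He Ze]]. exists e. split; [lia | assumption].
Qed.

(** Each of the two arcs between [a] and [b] has an interior zero, and [a], [b] keep these zeros
    apart. *)
Lemma cyclic_zeros (P Z M : nat -> Prop) n a b :
  (forall k, k < n -> P k \/ Z k \/ M k) ->
  (forall k, k < n -> P k -> M ((k + 1) mod n) -> False) ->
  (forall k, k < n -> M k -> P ((k + 1) mod n) -> False) ->
  (forall k, P k -> M k -> False) -> a < n -> b < n -> P a -> M b ->
  exists i j, nonconsecutive n i j /\ Z i /\ Z j.
Proof.
  assert (main : forall (P Z M : nat -> Prop) n a b,
    (forall k, k < n -> P k \/ Z k \/ M k) ->
    (forall k, k < n -> P k -> M ((k + 1) mod n) -> False) ->
    (forall k, k < n -> M k -> P ((k + 1) mod n) -> False) ->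
    (forall k, P k -> M k -> False) -> a < b -> b < n -> P a -> M b ->
    exists i j, nonconsecutive n i j /\ Z i /\ Z j).
  { clear. intros P Z M n a b Cov PM MP Dis Hab Hb Pa Mb.
    assert (Hm : forall k, k mod n < n) by (intro k; apply Nat.mod_upper_bound; lia).
    assert (Hs : forall k, S k mod n = (k mod n + 1) mod n).
    { intro k. rewrite <- Nat.add_1_r. now rewrite Nat.Div0.add_mod_idemp_l. }
    destruct (sign_change (fun k => P (k mod n)) (fun k => Z (k mod n)) (fun k => M (k mod n))
      a (b - a)) as [e [He Ze]]; auto.
    { intros k Hk. rewrite Hs. eauto. }
    { intros k. eauto. }
    { now rewrite Nat.mod_small by lia. }
    { rewrite Nat.mod_small by lia. now replace (a + (b - a)) with b by lia. }
    (* The second arc runs from [b] to [a + n], read modulo [n]. *)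
    destruct (sign_change (fun k => M (k mod n)) (fun k => Z (k mod n)) (fun k => P (k mod n))
      b (a + n - b)) as [e' [He' Ze']]; auto.
    { intros k. destruct (Cov (k mod n)) as [|[|]]; auto. }
    { intros k Hk. rewrite Hs. eauto. }
    { intros k. eauto. }
    { now rewrite Nat.mod_small by lia. }
    { replace (b + (a + n - b)) with (a + 1 * n) by lia.
      now rewrite Nat.Div0.mod_add, Nat.mod_small by lia. }
    exists ((a + e) mod n), ((b + e') mod n). split; [|now split].
    rewrite (Nat.mod_small (a + e)) by lia.
    destruct (le_lt_dec n (b + e')) as [H|H].
    - replace ((b + e') mod n) with (b + e' - n).
      + repeat split; rewrite ?Nat.mod_small; lia.
      + replace (b + e') with (b + e' - n + 1 * n) at 2 by lia.
        rewrite Nat.Div0.mod_add, Nat.mod_small; lia.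
    - rewrite (Nat.mod_small (b + e')) by lia. repeat split; try lia.
      + rewrite Nat.mod_small; lia.
      + destruct (Nat.eq_dec (b + e' + 1) n) as [E|E].
        * rewrite E, Nat.Div0.mod_same. lia.
        * rewrite Nat.mod_small; lia. }
  intros Cov PM MP Dis Ha Hb Pa Mb.
  destruct (lt_eq_lt_dec a b) as [[H|H]|H].
  - apply (main P Z M n a b); auto.
  - subst. exfalso. eauto.
  - apply (main M Z P n b a); eauto.
    intros k Hk. destruct (Cov k Hk) as [|[|]]; auto.
Qed.

Fixpoint lsum (f : nat -> nat) (n : nat) : nat :=
  match n with 0 => 0 | S n => lsum f n + f n end.

Lemma lsum_le f g n : (forall k, k < n -> f k <= g k) -> lsum f n <= lsum g n.
Proof.
  induction n as [|n IH]; simpl; intro H; [lia|].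
  specialize (IH (fun k Hk => H k (Nat.lt_lt_succ_r _ _ Hk))). specialize (H n). lia.
Qed.

Lemma lsum_lt f g n i : (forall k, k < n -> f k <= g k) -> i < n -> f i < g i ->
  lsum f n < lsum g n.
Proof.
  induction n as [|n IH]; simpl; intros H Hi Hlt; [lia|].
  destruct (Nat.eq_dec i n) as [->|].
  - assert (lsum f n <= lsum g n) by (apply lsum_le; auto). lia.
  - assert (f n <= g n) by auto. assert (lsum f n < lsum g n) by (apply IH; auto; lia). lia.
Qed.

Lemma filter_length_lt {T : Type} (f : T -> bool) q L : In q L -> f q = false ->
  length (filter f L) < length L.
Proof.
  intros Hq Hf. induction L as [|t L IH]; [contradiction|]. simpl.
  assert (H := filter_length_le f L). destruct Hq as [->|Hq].
  - rewrite Hf. lia.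
  - specialize (IH Hq). destruct (f t); simpl; lia.
Qed.

Definition clique (V : I -> Prop) : Prop := forall i j, V i -> V j -> i <> j -> m i j <> None.

Definition share_clique (n : nat) (x : nat -> W) : Prop :=
  exists a b, nonconsecutive n a b /\ exists g V, clique V /\
    gen V (g^-1 * (x a * g))%grp /\ gen V (g^-1 * (x b * g))%grp.

Context (n : nat) (x : nat -> W) (x_invol : forall k, (k < n)%nat -> (x k * x k = 1)%grp)
  (x_torsion : forall k, (k < n)%nat -> exists r, gpow (x k * x ((k + 1) mod n))%grp (S r) = 1%grp).

Local Open Scope grp_scope.

(** The sign of [x k] is its side of the edge [h<C>]. Neighbours cannot have opposite signs, their
    product having finite order, and zeros lie in the conjugate of [<C>] by [h]. *)
Lemma clique_at_edge A C D1 D2 h a b : splitting A C D1 D2 -> clique C ->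
  (forall k, (k < n)%nat -> gen A (h^-1 * (x k * h))) ->
  (a < n)%nat -> side C D1 (h^-1 * (x a * h)) ->
  (b < n)%nat -> side C D2 (h^-1 * (x b * h)) -> share_clique n x.
Proof.
  intros HS HC HA Ha Sa Hb Sb. set (y := fun k => h^-1 * (x k * h)).
  assert (Hm : forall k, ((k + 1) mod n < n)%nat) by (intro k; apply Nat.mod_upper_bound; lia).
  assert (tors : forall k, (k < n)%nat -> exists r, gpow (y k * y ((k + 1) mod n)) (S r) = 1).
  { intros k Hk. destruct (x_torsion k Hk) as [r E]. exists r. unfold y.
    replace (h^-1 * (x k * h) * (h^-1 * (x ((k + 1) mod n) * h))) with
      (h^-1 * ((x k * x ((k + 1) mod n)) * h)) by now gsimp.
    rewrite gpow_conj, E. now gsimp. }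
  assert (free : forall D D', splitting A C D D' -> forall k, (k < n)%nat -> side C D (y k) ->
    side C D' (y ((k + 1) mod n)) -> False).
  { intros D D' HS' k Hk S1 S2. destruct (tors k Hk) as [r E]. revert E.
    apply (opposite_sides_free A C D D'); unfold y; auto; apply conj_invol; auto. }
  destruct (cyclic_zeros (fun k => side C D1 (y k)) (fun k => gen C (y k))
    (fun k => side C D2 (y k)) n a b) as (i & j & Hij & Zi & Zj); auto.
  - intros k Hk. destruct (side_cases HS (y k) (HA k Hk)) as [|[|]]; auto.
  - apply (free D1 D2 HS).
  - apply (free D2 D1). now apply split_sym.
  - intro k. apply (side_disjoint HS).
  - exists i, j. split; [assumption|]. now exists h, C.
Qed.

(** With [z = u * v], lengths add both in [a * u], as [a] is shortest in [a<C>], and in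
    [(a * u) * v]. *)
Lemma len_not_side A C D1 D2 a z : splitting A C D1 D2 -> gen (join C D1) a -> jmin C a^-1 ->
  ~ side C D1 z -> len (a * z) = (len a + len z)%nat.
Proof.
  intros HS Ha Hm Hz. destruct (not_side z Hz) as (u & v & Hu & Hv & ->).
  rewrite (len_jmin C u v) by eauto using jmin_join.
  rewrite gmulA, (len_jmin (join C D1) (a * u) v); auto.
  - rewrite <- (len_inv (a * u)), ginvM, (len_jmin C), !len_inv; auto using gen_inv. lia.
  - apply gen_mul; auto. revert Hu. apply gen_mono. now left.
Qed.

Section Minimal.
Context (x_min : forall g, (lsum (fun k => len (x k)) n <=
  lsum (fun k => len (g^-1 * (x k * g))%grp) n)%nat).

(* If no fixed subtree lies beyond the base edge on the [D2] side and one of them misses the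
   vertex [<C+D1>], then conjugating by [a], where [a<C>] is the edge at this vertex that leads
   to the latter subtree, shortens the family, unless this edge separates two fixed subtrees. *)
Lemma one_sided A C D1 D2 : splitting A C D1 D2 -> clique C ->
  (forall k, (k < n)%nat -> gen A (x k)) ->
  (forall k, (k < n)%nat -> ~ side C D2 (x k)) ->
  share_clique n x \/ forall k, (k < n)%nat -> gen (join C D1) (x k).
Proof.
  intros HS HC HA HN. apply NNPP. intro No. apply not_or_and in No. destruct No as [No1 No2].
  apply not_all_ex_not in No2. destruct No2 as [i Hi]. apply imply_to_and in Hi.
  destruct Hi as [Hi Ni]. assert (HS' := split_sym _ _ _ _ HS).
  destruct (jmin_decomp (join C D1) (x i)) as (a0 & v & Ha0 & Hv & E).
  destruct (jmin_decomp C a0^-1) as (c' & b & Hc' & Hb & E').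
  set (a := b^-1). set (c := c'^-1).
  assert (Ea0 : a0 = a * c) by (unfold a, c; rewrite <- ginvM, <- E'; now gsimp).
  assert (Hc : gen C c) by now apply gen_inv.
  assert (Hc1 : gen (join C D1) c) by (revert Hc; apply gen_mono; now left).
  assert (Ha : gen (join C D1) a).
  { replace a with (a0 * c^-1) by (rewrite Ea0; now gsimp). apply gen_mul; auto using gen_inv. }
  assert (HaA : gen A a) by (apply (join_A HS); assumption).
  assert (Hva : gen A v).
  { rewrite <- (gmulK a0 v), <- E. apply gen_mul; auto. apply gen_inv, (join_A HS), Ha0. }
  assert (Hm : jmin C a^-1) by (unfold a; now rewrite ginvK).
  assert (Sv : side C D2 v).
  { destruct (side_cases HS v Hva) as [H|[H|H]]; auto; exfalso.
    - apply Ni. rewrite E. rewrite (jmin_gen C v) by eauto using jmin_join. now rewrite gmul1r.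
    - now apply jmin_join_side in H. }
  assert (Scv : side C D2 (c * v)) by now apply side_mull.
  assert (Na : a <> 1).
  { intro H. apply (HN i Hi). rewrite E, Ea0, H, gmul1. assumption. }
  set (z := fun k => a^-1 * (x k * a)).
  assert (HzA : forall k, (k < n)%nat -> gen A (z k)).
  { intros k Hk. unfold z. repeat apply gen_mul; auto using gen_inv. }
  assert (Szi : side C D2 (z i)).
  { unfold z. rewrite E, Ea0. gsimp. rewrite gmulA. apply (side_mulr HS); auto.
    apply gen_mul; auto. apply (join_A HS), Hc1. }
  destruct (classic (exists k, (k < n)%nat /\ side C D1 (z k))) as [[k [Hk Sk]]|H].
  { apply No1. now apply (clique_at_edge A C D1 D2 a k i). }
  assert (HL : forall w, ~ side C D1 w -> len (a * w) = (len a + len w)%nat).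
  { intros w Hw. now apply (len_not_side A C D1 D2). }
  assert (Hx : forall k, x k = a * (z k * a^-1)) by (intro k; unfold z; now gsimp).
  (* Here [x k = a * z k * a^-1] is reduced, so conjugation saves [2 * len a]. *)
  assert (Hlt : forall k, (k < n)%nat -> side C D2 (z k) -> (len (z k) < len (x k))%nat).
  { intros k Hk Sk. assert (Hz : z k * z k = 1) by (apply conj_invol; auto).
    assert (Sk' : side C D2 (z k * a^-1)).
    { apply (involution_side HS'); auto. apply (join_side2 HS). now apply gen_inv. }
    rewrite (Hx k), HL by (intro H1; exact (side_disjoint HS _ H1 Sk')).
    rewrite <- (len_inv (z k * _)), ginvM, ginvK, (ginv_invol _ Hz).
    rewrite HL by (intro H1; exact (side_disjoint HS _ H1 Sk)).
    assert (0 < len a)%nat by now apply len_pos. lia. }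
  assert (Hle : forall k, (k < n)%nat -> (len (z k) <= len (x k))%nat).
  { intros k Hk. destruct (side_cases HS (z k) (HzA k Hk)) as [Sk|[Sk|Sk]].
    (* For [z k] in [<C>], compare the lengths of [a * z k] and [x k * a], which are equal
       elements. *)
    - assert (L := HL (z k) (side_gen _ _ _ Sk)).
      replace (a * z k) with (x k * a) in L by (unfold z; now gsimp).
      assert (L' := len_mul (x k) a). lia.
    - exfalso. eauto.
    - apply Nat.lt_le_incl. auto. }
  assert (L := lsum_lt _ _ n i Hle Hi (Hlt i Hi Szi)). specialize (x_min a). fold z in x_min.
  unfold z in L. lia.
Qed.

(** Only [L] shrinks in the induction; the family stays fixed, so its minimality remains
    available. *)
Lemma chordal_share_clique (L : list I) : chordal m -> (4 <= n)%nat ->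
  (forall k, (k < n)%nat -> gen (fun i => In i L) (x k)) -> share_clique n x.
Proof.
  intros Hch Hn. induction L as [L IH] using (well_founded_induction
    (well_founded_ltof _ (@length I))). unfold ltof in IH. intro HL.
  set (A := fun i => In i L) in *.
  destruct (classic (clique A)) as [HA|HA].
  - exists 0, 2. split.
    + repeat split; rewrite ?Nat.mod_small; lia.
    + exists 1, A. split; [assumption|]. gsimp. split; apply HL; lia.
  - assert (exists p q, A p /\ A q /\ p <> q /\ m p q = None) as (p & q & Ap & Aq & Npq & Mpq).
    { apply NNPP. intro No. apply HA. intros p q Ap Aq Npq Mpq. apply No. now exists p, q. }
    assert (adj_sym : forall i j, pdiag_adj m i j -> pdiag_adj m j i).
    { intros i j [H1 H2]. split; [congruence|]. destruct HW as (_ & (_ & H & _) & _).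
      now rewrite H. }
    destruct (clique_separator adj_sym Hch A p q) as
      (C & D1 & D2 & Cov & HCA & HD1 & HD2 & Sep & Clq & Cp & D2p & Cq & D1q); auto.
    { now intros [_ H]. }
    assert (HS : splitting A C D1 D2).
    { split; auto. intros i j Hi Hj. destruct (Sep i j Hi Hj) as [Nij Nadj].
      split; [assumption|]. intro r. apply infinite_order. apply NNPP. intro H.
      apply Nadj. now split. }
    assert (HC : clique C) by (intros i j Hi Hj Nij; now apply Clq).
    assert (side_or : (forall k, (k < n)%nat -> ~ side C D1 (x k)) \/
      (forall k, (k < n)%nat -> ~ side C D2 (x k)) \/ share_clique n x).
    { apply NNPP. intro No. apply not_or_and in No as [No1 No]. apply not_or_and in No as [No2 No].
      apply not_all_ex_not in No1 as [a Ha]. apply imply_to_and in Ha as [Ha Sa].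
      apply not_all_ex_not in No2 as [b Hb]. apply imply_to_and in Hb as [Hb Sb].
      apply NNPP in Sa, Sb. apply No.
      apply (clique_at_edge A C D1 D2 1 a b); auto; gsimp; auto.
      intros k Hk. gsimp. auto. }
    assert (smaller : forall D r, A r -> ~ C r -> ~ D r ->
      (forall k, (k < n)%nat -> gen (join C D) (x k)) -> (forall i, D i -> A i) ->
      share_clique n x).
    { intros D r Ar Cr Dr HD DA.
      set (f := fun i => if excluded_middle_informative (join C D i) then true else false).
      apply (IH (filter f L)).
      - apply (filter_length_lt f r); [assumption|]. unfold f.
        destruct (excluded_middle_informative (join C D r)) as [[|]|]; tauto.
      - intros k Hk. generalize (HD k Hk). apply gen_mono. intros i Hi. apply filter_In.
        split; [destruct Hi as [Hi|Hi]; [now apply HCA | now apply DA]|].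
        unfold f. now destruct (excluded_middle_informative (join C D i)). }
    (* Passing to [C+D2] drops [p], and passing to [C+D1] drops [q]. *)
    destruct side_or as [H|[H|H]]; [| |assumption].
    + destruct (one_sided A C D2 D1) as [H1|H1]; auto using split_sym.
      apply (smaller D2 p); auto.
    + destruct (one_sided A C D1 D2) as [H1|H1]; auto.
      apply (smaller D1 q); auto.
Qed.
End Minimal.
End CyclicFamily.
End CoxeterSystem.

(** * Comparison of two sets of Coxeter generators *)

Theorem theorem3p3 (W : group) (I : Type) (s : I -> W) (m : I -> I -> option nat) :
  coxeter_presentation W I s m -> finite_type I -> chordal m ->
  forall (I' : Type) (s' : I' -> W) (m' : I' -> I' -> option nat),
    coxeter_presentation W I' s' m' -> chordal m'.
Proof.
  intros HW [L HL] Hch I' s' m' HW' c n Hn [Hinj Hadj]. apply NNPP. intro No.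
  set (x := fun k => s' (c k)).
  assert (x_invol : forall k, (k < n)%nat -> x k * x k = 1) by (intros; apply (sK HW')).
  assert (x_torsion : forall k, (k < n)%nat ->
    exists r, gpow (x k * x ((k + 1) mod n)) (S r) = 1).
  { intros k Hk. destruct (Hadj k Hk) as [Nk Mk].
    destruct HW' as (_ & (_ & _ & H2) & H3 & _).
    destruct (m' (c k) (c ((k + 1) mod n))) as [[|r]|] eqn:E; [|eauto|contradiction].
    apply H2 in E; [lia | assumption]. }
  destruct (least_nat (fun N => exists g, lsum (fun k => len HW (g^-1 * (x k * g))) n = N))
    as [N [[g <-] Hg]]; [eexists; exists 1; reflexivity|].
  set (y := fun k => g^-1 * (x k * g)).
  destruct (chordal_share_clique HW n y) with (L := L) as
    (a & b & (Ha & Hb & Nab & Nb & Na) & h & V & HV & Va & Vb); auto.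
  - intros k Hk. apply conj_invol. auto.
  - intros k Hk. destruct (x_torsion k Hk) as [r E]. exists r. unfold y.
    replace (g^-1 * (x k * g) * (g^-1 * (x ((k + 1) mod n) * g))) with
      (g^-1 * ((x k * x ((k + 1) mod n)) * g)) by now gsimp.
    rewrite gpow_conj, E. now gsimp.
  - intro h. apply Hg. exists (g * h). f_equal. extensionality k. unfold y. now gsimp.
  - intros k Hk. generalize (gen_all HW (y k)). apply gen_mono. auto.
  (* Undoing both conjugations, [P] is the conjugate of the clique [V] by [g * h]; it generates a
     subgroup containing [x a] and [x b]. *)
  - set (P := fun w => exists i, V i /\ w = (g * h) * (s i * (g * h)^-1)).
    assert (Hcl : forall w, gen s V (h^-1 * ((g^-1 * (w * g)) * h)) -> closure P w).
    { intros w Hw.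
      assert (H : forall v, gen s V v -> closure P ((g * h) * (v * (g * h)^-1))).
      { apply gen_ind.
        - gsimp. constructor.
        - intros i v Hi Hv.
          replace (g * h * (s i * v * (g * h)^-1)) with
            (((g * h) * (s i * (g * h)^-1)) * ((g * h) * (v * (g * h)^-1))) by now gsimp.
          constructor; [now exists i | assumption]. }
      apply H in Hw. revert Hw. gsimp. auto. }
    apply (infinite_pair_not_generated HW' P) with (k := c a) (l := c b).
    + intros w [i [_ ->]]. gsimp. rewrite (sKl HW). now gsimp.
    + intros v w [i [Hi ->]] [j [Hj ->]].
      replace (g * h * (s i * (g * h)^-1) * (g * h * (s j * (g * h)^-1))) with
        (((g * h)^-1)^-1 * ((s i * s j) * (g * h)^-1)) by now gsimp.
      destruct (classic (i = j)) as [<-|Nij].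
      * exists 0. rewrite gpow_conj. simpl. rewrite (sK HW). now gsimp.
      * assert (Mij := HV i j Hi Hj Nij). pose proof HW as (_ & (_ & _ & H2) & H3 & _).
        destruct (m i j) as [[|r]|] eqn:E; [|exists r|contradiction].
        -- apply H2 in E; [lia | assumption].
        -- rewrite gpow_conj, (H3 i j _ E). now gsimp.
    + intro E. apply Nab. now apply Hinj.
    (* A finite label would make [a], [b] a chord. *)
    + intro r. apply (infinite_order HW'). apply NNPP. intro H. apply No.
      exists a, b. repeat split; auto.
    + apply Hcl. exact Va.
    + apply Hcl. exact Vb.
Qed.
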